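(* Let $n>1$ be an odd integer. Let $G$ be a graph isomorphic to $(K_{n-1}-M)+K_1$, where $M$ is any perfect matching of $K_{n-1}$. If $\Gamma$ is any abelian group with $|\Gamma|=n$, then $G$ admits a $\Gamma$-distance magic labeling $l$ if and only if $l(v_0)=e$, where $G[\{v_0\}]=K_1$.
   Context: All graphs are finite and simple; all groups are finite additive abelian groups, and $e$ denotes the identity element of $\Gamma$. $N_G(u)$ is the set of vertices adjacent to $u$ in $G$. For a graph $G$ and an abelian group $\Gamma$ with $|V(G)|=|\Gamma|$, a $\Gamma$-distance magic labeling of $G$ is a bijection $l:V(G)\to\Gamma$ for which there is an element $\mu_0\in\Gamma$ such that $w_G(u)=\sum_{v\in N_G(u)}l(v)=\mu_0$ for every $u\in V(G)$. $K_{n-1}$ is the complete graph on $n-1$ vertices, $K_{n-1}-M$ is the graph obtained from it by deleting the edges of $M$, and $G_1+G_2$ denotes the join of $G_1$ and $G_2$ (their disjoint union together with all edges between $V(G_1)$ and $V(G_2)$). $G[S]$ denotes the subgraph of $G$ induced by $S\subseteq V(G)$; $v_0$ is the vertex of $G$ that induces the $K_1$ in the join $(K_{n-1}-M)+K_1$. *)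

(* Defs.v *)
From mathcomp Require Import all_boot all_algebra.

Set Implicit Arguments.
Unset Strict Implicit.
Unset Printing Implicit Defensive.

Import GRing.Theory.
Local Open Scope ring_scope.

Record sgraph := SGraph {
  vertex :> finType;
  adj : rel vertex;
  adj_sym : symmetric adj;
  adj_irr : irreflexive adj
}.

Definition nbhd (G : sgraph) (u : G) : {set G} := [set v | adj u v].

Definition edges (G : sgraph) : {set {set G}} :=
  [set [set p.1; p.2] | p : G * G & adj p.1 p.2].

Lemma complete_sym (m : nat) : symmetric (fun i j : 'I_m => i != j).
Proof. by move=> i j; rewrite eq_sym. Qed.

Lemma complete_irr (m : nat) : irreflexive (fun i j : 'I_m => i != j).
Proof. by move=> i; rewrite eqxx. Qed.

Definition complete (m : nat) : sgraph :=
  SGraph (@complete_sym m) (@complete_irr m).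

Definition perfect_matching (G : sgraph) (M : {set {set G}}) : Prop :=
  [/\ M \subset edges G, trivIset M & cover M = [set: G]].

Section DeleteEdges.
Variables (G : sgraph) (M : {set {set G}}).

Definition del_adj : rel G := fun x y => adj x y && ([set x; y] \notin M).

Lemma del_adj_sym : symmetric del_adj.
Proof. by move=> x y; rewrite /del_adj adj_sym setUC. Qed.

Lemma del_adj_irr : irreflexive del_adj.
Proof. by move=> x; rewrite /del_adj adj_irr. Qed.

Definition del_edges : sgraph := SGraph del_adj_sym del_adj_irr.
End DeleteEdges.

Section Join.
Variables (G H : sgraph).

Definition join_adj : rel (G + H)%type := fun x y =>
  match x, y with
  | inl a, inl b => adj a b
  | inr a, inr b => adj a b
  | _, _ => true
  end.

Lemma join_adj_sym : symmetric join_adj.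
Proof. by move=> [a|a] [b|b] //=; rewrite adj_sym. Qed.

Lemma join_adj_irr : irreflexive join_adj.
Proof. by move=> [a|a] /=; rewrite adj_irr. Qed.

Definition join : sgraph := SGraph join_adj_sym join_adj_irr.
End Join.

Definition graph_iso (G H : sgraph) (f : G -> H) : Prop :=
  bijective f /\ forall x y : G, adj (f x) (f y) = adj x y.

Definition weight (G : sgraph) (A : finZmodType) (l : G -> A) (u : G) : A :=
  \sum_(v in nbhd u) l v.

(* The requirement #|G| = #|A| is implied by bijectivity. *)
Definition distance_magic_labeling (G : sgraph) (A : finZmodType)
    (l : G -> A) : Prop :=
  bijective l /\ exists mu0 : A, forall u : G, weight l u = mu0.

(* Main.v *)
(** Let [p] be the involution exchanging the endpoints of every edge of [M],
    let [T] be the sum of the labels of the vertices other than [v0], and let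
    [x] be the label of [v0].  The vertex [v0] has weight [T], and [u <> v0]
    has weight [T + x - l u - l (p u)]; so [l] is magic iff
    [l u + l (p u) = x] for all [u <> v0].  Summing over [u] gives
    [2 T = (n - 1) x].  Since [T + x] is the sum of all elements of [A], and
    negation permutes [A], [2 (T + x) = 0]; thus [x = (n + 1) x = 0].
    Conversely, as [n] is odd, negation is a fixed-point-free involution of
    the nonzero elements, so they can be matched equivariantly with the
    vertices other than [v0] under [p]; that makes [l u + l (p u) = 0]. *)

Require Import Defs.
From mathcomp Require Import all_boot all_algebra all_fingroup cyclic.

Set Implicit Arguments.
Unset Strict Implicit.
Unset Printing Implicit Defensive.

Import GRing.Theory.
Local Open Scope ring_scope.

Lemma double_sum_finZmod (A : finZmodType) : (\sum_(a : A) a) *+ 2 = 0.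
Proof.
rewrite mulr2n -{1}(opprK (\sum_(a : A) a)) -sumrN.
rewrite [X in - X + _](reindex_inj oppr_inj) /=.
by under eq_bigr do rewrite opprK; rewrite addNr.
Qed.

Lemma mulrn_card (A : finZmodType) (a : A) : a *+ #|A| = 0.
Proof. by rewrite -cardsT -FinRing.zmodXgE expg_cardG ?inE. Qed.

(** If [- a = a] then [a *+ 2 = 0], so the odd multiple [a *+ #|A|] is [a] itself, while Lagrange
    makes it zero. *)
Lemma oppr_neq_of_odd_card (A : finZmodType) (a : A) :
  odd #|A| -> a != 0 -> - a != a.
Proof.
move=> oddA; apply: contraNneq => aN.
have a2 : a *+ 2 = 0 by rewrite mulr2n -{1}aN addNr.
have := mulrn_card a.
rewrite -(odd_double_half #|A|) oddA -mul2n mulrnDr mulrnA a2 mul0rn addr0.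
by move/eqP.
Qed.

(** Both sets split into orbits of size two. Strong induction on [#|D|] removes one orbit from each
    side and sends [a] to [b] and [f a] to [g b]. Outside [D] the values of [h] are irrelevant; [u0]
    only serves as a default. *)
Lemma equivariant_injection (T U : finType) (f : T -> T) (g : U -> U) (u0 : U)
    (D : {set T}) (E : {set U}) :
  involutive f -> involutive g ->
  {in D, forall x, f x \in D} -> {in E, forall y, g y \in E} ->
  {in D, forall x, f x != x} -> {in E, forall y, g y != y} ->
  #|D| = #|E| ->
  exists h : T -> U, [/\ {in D, forall x, h x \in E}, {in D &, injective h}
                       & {in D, forall x, h (f x) = g (h x)}].
Proof.
move=> fK gK.
have [k] := ubnP #|D|; elim: k D E => // k IH D E ltDk fD gE fD' gE' cDE.
have [D0|[a aD]] := set_0Vmem D.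
  by exists (fun=> u0); rewrite D0; split=> x; rewrite inE.
have [b bE] : exists b, b \in E.
  by apply/card_gt0P; rewrite -cDE; apply/card_gt0P; exists a.
have memD x : (x \in D :\ a :\ f a) = [&& x != f a, x != a & x \in D].
  by rewrite !inE.
have memE y : (y \in E :\ b :\ g b) = [&& y != g b, y != b & y \in E].
  by rewrite !inE.
have cD : #|D| = #|D :\ a :\ f a|.+2.
  by rewrite (cardsD1 a D) aD (cardsD1 (f a) (D :\ a)) !inE fD' // fD.
have cE : #|E| = #|E :\ b :\ g b|.+2.
  by rewrite (cardsD1 b E) bE (cardsD1 (g b) (E :\ b)) !inE gE' // gE.
have ffx x : (f x == f a) = (x == a) by rewrite (inj_eq (inv_inj fK)).
have fxa x : (f x == a) = (x == f a) by rewrite -(inj_eq (inv_inj fK)) fK.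
have ggy y : (g y == g b) = (y == b) by rewrite (inj_eq (inv_inj gK)).
have gyb y : (g y == b) = (y == g b) by rewrite -(inj_eq (inv_inj gK)) gK.
have [||||||h [hE hI hf]] := IH (D :\ a :\ f a) (E :\ b :\ g b).
- by rewrite -ltnS (ltn_trans _ ltDk) // cD.
- by move=> x; rewrite !memD ffx fxa => /and3P[-> -> /fD].
- by move=> y; rewrite !memE ggy gyb => /and3P[-> -> /gE].
- by move=> x; rewrite memD => /and3P[_ _ /fD'].
- by move=> y; rewrite memE => /and3P[_ _ /gE'].
- by move: cD; rewrite cDE cE => -[].
exists (fun x => if x == a then b else if x == f a then g b else h x).
have hE' x : x \in D -> x != a -> x != f a ->
    [&& h x != g b, h x != b & h x \in E].
  by move=> xD xa xfa; rewrite -memE hE // memD xD xa xfa.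
split.
- move=> x xD; have [//|xa] := eqVneq x a; have [_|xfa] := eqVneq x (f a).
    exact: gE.
  by have /and3P[] := hE' _ xD xa xfa.
- move=> x y xD yD.
  have [->|xa] := eqVneq x a; have [->|ya] := eqVneq y a => //.
  + have [_ e|yfa e] := eqVneq y (f a).
      by have := gE' _ bE; rewrite -e eqxx.
    by have := hE' _ yD ya yfa; rewrite -e eqxx andbF.
  + have [_ e|xfa e] := eqVneq x (f a).
      by have := gE' _ bE; rewrite e eqxx.
    by have := hE' _ xD xa xfa; rewrite e eqxx andbF.
  have [->|xfa] := eqVneq x (f a); have [->|yfa] := eqVneq y (f a) => // e.
  + by have := hE' _ yD ya yfa; rewrite -e eqxx.
  + by have := hE' _ xD xa xfa; rewrite e eqxx.
  by apply: hI e; rewrite memD ?xD ?yD ?xa ?ya ?xfa ?yfa.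
move=> x xD; rewrite ffx fxa.
have [->|xa] := eqVneq x a; first by rewrite eq_sym (negPf (fD' _ aD)).
have [_|xfa] := eqVneq x (f a); first by rewrite gK.
by rewrite hf // memD xa xfa.
Qed.

Lemma perfect_matching_involution (G : sgraph) (M : {set {set G}}) :
  perfect_matching M ->
  exists p : G -> G, [/\ involutive p, forall u, p u != u
                       & forall u v, ([set u; v] \in M) = (v == p u)].
Proof.
move=> [/subsetP sME tI cM].
have exP u : exists v, [set u; v] \in M.
  have: u \in cover M by rewrite cM inE.
  case/bigcupP=> e eM ue; have /imsetP[[a b] _ /= eE] := sME _ eM.
  move: ue; rewrite eE !inE => /orP[]/eqP->; first by exists b; rewrite -eE.
  by exists a; rewrite setUC -eE.
(* With [u = v] the edge would be a singleton, hence a loop. *)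
have neqP u v : [set u; v] \in M -> u != v.
  move=> /sME/imsetP[[a b]] /=; rewrite inE /= => ab.
  move=> e; apply: contraTneq ab => uv; move: e; rewrite uv setUid => e.
  have: a \in [set v] by rewrite e !inE eqxx.
  have: b \in [set v] by rewrite e !inE eqxx orbT.
  by rewrite !inE => /eqP-> /eqP->; rewrite adj_irr.
(* Both edges are the block of the partition [M] that contains [u]. *)
have uniqP u v w : [set u; v] \in M -> [set u; w] \in M -> v = w.
  move=> uvM uwM.
  have e : [set u; v] = [set u; w].
    by rewrite -(def_pblock tI uvM (set21 u v)) (def_pblock tI uwM (set21 u w)).
  have: v \in [set u; w] by rewrite -e set22.
  by rewrite !inE eq_sym (negPf (neqP _ _ uvM)) => /eqP.
pose p u := xchoose (exP u).
have pM u : [set u; p u] \in M := xchooseP (exP u).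
have pP u v : ([set u; v] \in M) = (v == p u).
  by apply/idP/eqP => [uvM|->//]; apply: uniqP uvM (pM u).
exists p; split=> // u; last by rewrite eq_sym neqP.
by apply/esym/eqP; rewrite -pP setUC.
Qed.

Lemma weight_iso (G H : sgraph) (A : finZmodType) (f : G -> H) (l : H -> A) u :
  graph_iso f -> weight l (f u) = weight (l \o f) u.
Proof.
move=> [bf af]; rewrite /weight (reindex f) /=; last exact: onW_bij.
by apply: eq_bigl => v; rewrite !inE af.
Qed.

Section Cone.

Variables (m : nat) (M : {set {set complete m}}) (p : 'I_m -> 'I_m).
Hypothesis p_neq : forall u, p u != u.
Hypothesis pE : forall u v : complete m, ([set u; v] \in M) = (v == p u).
Variables (A : finZmodType) (l : join (del_edges M) (complete 1) -> A).

Lemma weight_apex : weight l (inr ord0) = \sum_(i < m) l (inl i).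
Proof.
rewrite /weight big_mkcond big_sumType /= big_ord1 !inE /= addr0.
by apply: eq_bigr => i _; rewrite inE.
Qed.

(** A base vertex misses only itself and its partner, so adding their two labels back completes the
    sum over all vertices. *)
Lemma weight_base (i : 'I_m) :
  weight l (inl i) + (l (inl i) + l (inl (p i)))
  = \sum_(j < m) l (inl j) + l (inr ord0).
Proof.
rewrite /weight big_mkcond big_sumType /= big_ord1 inE /= -big_mkcond /=.
rewrite [in RHS](bigD1 i) //= [in RHS](bigD1 (p i)) //=.
rewrite (eq_bigl (fun j => (j != i) && (j != p i))); last first.
  by move=> j; rewrite !inE /= /del_adj /= pE eq_sym.
set s := \sum_(_ < m | _) _.
by rewrite [LHS]addrC !addrA.
Qed.

End Cone.

(** Letting [x] range over the possible labels of [v0] captures both claims: every magic labeling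
    has the identity at [v0], and such a labeling exists. *)
Theorem theorem2p3 (n : nat) (n_gt1 : (1 < n)%N) (n_odd : odd n)
    (M : {set {set complete n.-1}}) (perfM : perfect_matching M)
    (G : sgraph) (phi : join (del_edges M) (complete 1) -> G)
    (phi_iso : graph_iso phi)
    (v0 : G) (v0E : v0 = phi (inr ord0))
    (A : finZmodType) (cardA : #|A| = n) (x : A) :
  (exists l : G -> A, distance_magic_labeling l /\ l v0 = x) <-> x = 0.
Proof.
have [p [pK p_neq pE]] := perfect_matching_involution perfM.
have mn : n.-1.+1 = n by rewrite prednK // ltnW.
have [bphi aphi] := phi_iso; split=> [[l [[bl [mu lmu]] lx]]|->].
  pose l' := l \o phi; pose S : A := \sum_(i < n.-1) l' (inl i).
  have wl' u : weight l' u = mu by rewrite -weight_iso.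
  have SE : S = mu by rewrite -(wl' (inr ord0)) weight_apex.
  have l'0 : l' (inr ord0) = x by rewrite /l' /= -v0E.
  (* The weight of the base vertex and the sum [S] both equal [mu] and cancel. *)
  have pairE i : l' (inl i) + l' (inl (p i)) = x.
    have := weight_base p_neq pE l' i.
    by rewrite wl' -/S SE l'0; apply: addrI.
  have S2 : S *+ 2 = x *+ n.-1.
    rewrite mulr2n {2}/S (reindex_inj (inv_inj pK)) /= -big_split /=.
    by under eq_bigr do rewrite pairE; rewrite sumr_const card_ord.
  have sumA : \sum_(a : A) a = S + x.
    rewrite (reindex l') /=; last exact/onW_bij/bij_comp.
    by rewrite big_sumType /= big_ord1 l'0.
  have := double_sum_finZmod A.
  rewrite sumA mulrnDl S2 -mulrnDr addn2 mn mulrSr -{1}cardA.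
  by rewrite mulrn_card add0r.
have oddA : odd #|A| by rewrite cardA.
(* The base vertices and the nonzero elements both number [n.-1]; the apex takes the remaining label
   0. *)
have [|||||h [hE hI hp]] := @equivariant_injection _ _ p (@GRing.opp A) 0
    [set: 'I_n.-1] [set~ 0] pK (@opprK A).
- by move=> *; rewrite inE.
- by move=> y; rewrite !inE oppr_eq0.
- by move=> i _; apply: p_neq.
- by move=> y; rewrite !inE; apply: oppr_neq_of_odd_card.
- by rewrite cardsT card_ord cardsC1 cardA.
pose l' (u : join (del_edges M) (complete 1)) : A :=
  if u is inl i then h i else 0.
have h_neq0 i : h i != 0 by have := hE i; rewrite !inE; apply.
have l'I : injective l'.
  move=> [i|i] [j|j] //= e; last by rewrite !ord1.
  - by rewrite (hI i j) ?inE.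
  - by have := h_neq0 i; rewrite e eqxx.
  - by have := h_neq0 j; rewrite -e eqxx.
have bl' : bijective l'.
  by apply: inj_card_bij l'I _; rewrite card_sum !card_ord addn1 mn cardA.
have [psi phiK psiK] := bphi.
exists (l' \o psi); split; last by rewrite v0E /= phiK.
split; first by apply: bij_comp bl' _; exists phi.
(* The magic constant is read off from the apex, whose neighbours are all the base vertices. *)
exists (\sum_(i < n.-1) h i) => u; rewrite -(psiK u) weight_iso //.
have -> : weight ((l' \o psi) \o phi) (psi u) = weight l' (psi u).
  by apply: eq_bigr => v _; rewrite /= phiK.
case: (psi u) => [i|i]; last by rewrite ord1 weight_apex.
have := weight_base p_neq pE l' i.
by rewrite /= hp ?inE // subrr !addr0.
Qed.
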